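(* Let $(X,\rho)$ be a separable and complete Heine-Borel metric space with Borel $\sigma$-algebra $\mathscr{B}$, let $\{\nu_n\}_{n=1}^\infty$ be a sequence of finite Borel measures on $X$ and let $\nu$ be a finite Borel measure on $X$. Then the following conditions are equivalent. (I) $\nu_n$ converges vaguely to $\nu$ as $n\to\infty$. (II) For any compact set $A\subset X$, $\limsup_{n\to\infty}\nu_n(A)\le\nu(A)$, while for any bounded open set $B\subset X$, $\liminf_{n\to\infty}\nu_n(B)\ge\nu(B)$. (III) For any bounded closed set $A\subset X$, $\limsup_{n\to\infty}\nu_n(A)\le\nu(A)$, while for any bounded open set $B\subset X$, $\liminf_{n\to\infty}\nu_n(B)\ge\nu(B)$. (IV) For any bounded set $A\in\mathscr{B}$, $\nu(A^o)\le\liminf_{n\to\infty}\nu_n(A)\le\limsup_{n\to\infty}\nu_n(A)\le\nu(\overline{A})$. (V) $\lim_{n\to\infty}\nu_n(A)=\nu(A)$ for any bounded $\nu$-continuity set $A\in\mathscr{B}$. (VI) $\lim_{n\to\infty}\int_X f\,d\nu_n=\int_X f\,d\nu$ for any continuous function $f:X\to\mathbb{R}$ with bounded support. (VII) $\lim_{n\to\infty}\int_X f\,d\nu_n=\int_X f\,d\nu$ for any H\''older continuous function $f\in C_c(X)$. (VIII) $\lim_{n\to\infty}\int_X f\,d\nu_n=\int_X f\,d\nu$ for any uniformly continuous function $f\in C_c(X)$. (IX) $\lim_{n\to\infty}\int_X f\,d\nu_n=\int_X f\,d\nu$ for any bounded measurable function $f:X\to\mathbb{R}$ with bounded support and $\nu(\{x\in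 X: f\text{ is discontinuous at }x\})=0$. (X) $\lim_{n\to\infty}\int_X f\,d\nu_n=\int_X f\,d\nu$ for any non-negative (or, alternatively, for any non-positive) valued function $f\in C_c(X)$.
   Context: A metric space is a Heine-Borel space if every closed bounded subset of it is compact. $A^o$, $\overline{A}$, $\partial A$ denote the interior, closure and boundary of $A$. A set $A$ is a $\nu$-continuity set if $\nu(\partial A)=0$. The support of $f:X\to\mathbb{R}$ is the closure of $\{x: f(x)\neq 0\}$. $C_c(X)$ is the set of continuous functions $X\to\mathbb{R}$ with compact support. The sequence $\nu_n$ converges vaguely to $\nu$ if $\lim_{n\to\infty}\int_X f\,d\nu_n=\int_X f\,d\nu$ for every $f\in C_c(X)$. A function $f$ is H\''older continuous if there are $C\ge 0$ and $\alpha\in(0,1]$ with $|f(x)-f(y)|\le C\rho(x,y)^\alpha$ for all $x,y\in X$. *)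

(* Defs.v *)
From HB Require Import structures.
From mathcomp Require Import all_boot all_order all_algebra.
From mathcomp Require Import all_classical all_reals all_analysis.

Set Implicit Arguments.
Unset Strict Implicit.
Unset Printing Implicit Defensive.

Import Order.TTheory GRing.Theory Num.Theory.
Import numFieldNormedType.Exports.

Local Open Scope classical_set_scope.
Local Open Scope ring_scope.

#[short(type="completeMetricType")]
HB.structure Definition CompleteMetric (R : numDomainType) :=
  {M of Metric R M & Complete M}.

(* The carrier X equipped with its Borel sigma-algebra *)
Notation borel X := (g_sigma_algebraType (@open X)).

Section topological_notions.
Context {T : topologicalType}.

Definition separable_space := exists2 D : set T, countable D & dense D.

Definition boundary (A : set T) : set T := closure A `\` A°.

(* The name support is taken by the algebraic (unclosed) support of ssralg *)
Definition tsupport {R : realType} (f : T -> R) : set T :=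
  closure [set x | f x != 0].

Definition Cc {R : realType} (f : T -> R) : Prop :=
  continuous f /\ compact (tsupport f).

Definition discontinuity_set {R : realType} (f : T -> R) : set T :=
  [set x | ~ {for x, continuous f}].

End topological_notions.
Arguments separable_space : clear implicits.

Section metric_notions.
Context {R : realType} {X : metricType R}.

(* The library's bounded_set is only available in normed modules *)
Definition metric_bounded (A : set X) : Prop :=
  exists M : R, forall x y, A x -> A y -> mdist x y <= M.

Definition hoelder_continuous (f : X -> R) : Prop :=
  exists C alpha : R, [/\ 0 <= C, 0 < alpha <= 1 &
    forall x y, `|f x - f y| <= C * (mdist x y) `^ alpha].

End metric_notions.

Definition Heine_Borel_space {R : realType} (X : metricType R) : Prop :=
  forall A : set X, closed A -> metric_bounded A -> compact A.

Section convergence_of_measures.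
Context {R : realType} {X : completeMetricType R}.
Variables (nu_ : nat -> {finite_measure set (borel X) -> \bar R})
          (nu : {finite_measure set (borel X) -> \bar R}).

(* Every function this is used for is bounded, measurable, and hence integrable
   for the finite measures nu_ n and nu: the extended-real integrals are finite *)
Definition integral_cvg (f : X -> R) : Prop :=
  (\int[nu_ n]_x (f x)%:E)%E @[n --> \oo] --> (\int[nu]_x (f x)%:E)%E.

Definition vague_cvg : Prop := forall f : X -> R, Cc f -> integral_cvg f.

Definition continuity_set (A : set X) : Prop := nu (boundary A) = 0%E.

End convergence_of_measures.

(* Main.v *)
(* Everything revolves around (III).  Hoelder test functions already suffice to
   get it: the truncated multiples min(1, k d(x, A)) of the distance to a closed
   set A are Lipschitz and converge to the indicator of the complement of A,
   and near a bounded set they have bounded, hence compact, support.  (III)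
   gives (IV) by monotonicity and (V) by squeezing.  Conversely (V) gives (III)
   because among the thickenings of a closed set all but countably many are
   continuity sets.  Finally (IV) gives (IX), hence convergence for all the
   classes of test functions, by slicing a nonnegative f with bounded support
   into finitely many layers delta * 1_{f > i delta}. *)
Require Import Defs.
From mathcomp Require Import all_boot all_order all_algebra.
From mathcomp Require Import all_classical all_reals all_analysis.
From mathcomp Require Import measurable_realfun.

Import Order.TTheory GRing.Theory Num.Theory.
Import numFieldNormedType.Exports.

Local Open Scope classical_set_scope.
Local Open Scope ring_scope.
Local Open Scope ereal_scope.

Section capped_distance.
Local Open Scope ring_scope.
Context {R : realType} {X : metricType R}.
Implicit Types (A : set X) (x y : X) (k : R).

(* Capping at 1 makes the infimum meaningful for [A = set0] as well: the
   distance to the empty set is then the constant 1. *)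
Definition capped_dist A x : R :=
  inf ([set 1] `|` [set mdist x a | a in A]).

Let dist_set_lb A x : lbound ([set 1] `|` [set mdist x a | a in A]) 0.
Proof. by move=> _ [->|[a _ <-]] //; exact: mdist_ge0. Qed.

Let dist_set_has_inf A x : has_inf ([set 1] `|` [set mdist x a | a in A]).
Proof. by split; [exists 1; left|exists 0; exact: dist_set_lb]. Qed.

Lemma capped_dist_ge0 A x : 0 <= capped_dist A x.
Proof. by apply: lb_le_inf; [exists 1; left|exact: dist_set_lb]. Qed.

Lemma capped_dist_le1 A x : capped_dist A x <= 1.
Proof. by apply: ge_inf; [exists 0; exact: dist_set_lb|left]. Qed.

Lemma capped_dist_le A x a : A a -> capped_dist A x <= mdist x a.
Proof.
by move=> Aa; apply: ge_inf; [exists 0; exact: dist_set_lb|right; exists a].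
Qed.

Lemma capped_dist_lt A x k : k <= 1 -> capped_dist A x < k ->
  exists2 a, A a & mdist x a < k.
Proof.
move=> k1 dk; have k0 : 0 < k - capped_dist A x by rewrite subr_gt0.
have [_ [->|[a Aa <-]]] := inf_adherent k0 (dist_set_has_inf A x).
  by rewrite addrC subrK ltNge k1.
by rewrite addrC subrK => ?; exists a.
Qed.

Lemma capped_dist0 A x : A x -> capped_dist A x = 0.
Proof.
move=> Ax; apply/eqP; rewrite eq_le capped_dist_ge0 andbT.
by rewrite (le_trans (capped_dist_le A x x Ax)) ?mdistxx.
Qed.

Lemma capped_dist_gt0 A x : closed A -> ~ A x -> 0 < capped_dist A x.
Proof.
move=> cA nAx; rewrite lt_neqAle capped_dist_ge0 andbT eq_sym.
apply/eqP => d0; apply: nAx; apply: cA => B /nbhs_ballP[e /= e0 eB].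
have /capped_dist_lt[|a Aa] : capped_dist A x < Num.min e 1.
- by rewrite d0 lt_min e0 ltr01.
- by rewrite ge_min lexx orbT.
- rewrite lt_min => /andP[xae _].
  by exists a; split => //; apply: eB; rewrite ballEmdist.
Qed.

Lemma capped_dist_lipschitz A x y :
  `|capped_dist A x - capped_dist A y| <= mdist x y.
Proof.
wlog suff h : x y / capped_dist A x - capped_dist A y <= mdist x y.
  by rewrite ler_norml h lerNl opprB metric_sym h.
rewrite lerBlDr; apply/ler_addgt0Pl => e e0.
have [_ [->|[a Aa <-]] ae] := inf_adherent e0 (dist_set_has_inf A y).
  rewrite (le_trans (capped_dist_le1 A x))// -[leLHS]add0r addrCA lerD//.
    exact: mdist_ge0.
  by rewrite addrC ltW.
rewrite (le_trans (capped_dist_le A x a Aa))//.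
rewrite (le_trans (metric_triangle _ y _))// addrCA lerD2l.
by rewrite addrC ltW.
Qed.

Lemma lipschitz_continuous (f : X -> R) k : 0 <= k ->
  (forall x y, `|f x - f y| <= k * mdist x y) -> continuous f.
Proof.
move=> k0 fk x; apply/cvgrPdist_lt => e e0.
have k1 : 0 < k + 1 by rewrite ltr_wpDl.
near=> y; rewrite (le_lt_trans (fk _ _))//.
rewrite (@le_lt_trans _ _ ((k + 1) * mdist x y))//.
  by rewrite ler_wpM2r ?mdist_ge0// lerDl.
rewrite mulrC -ltr_pdivlMr//.
near: y; apply/nbhs_ballP; exists (e / (k + 1)); first exact: divr_gt0.
by move=> y; rewrite ballEmdist.
Unshelve. all: by end_near. Qed.

Lemma lipschitz_hoelder (f : X -> R) k : 0 <= k ->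
  (forall x y, `|f x - f y| <= k * mdist x y) -> hoelder_continuous f.
Proof.
move=> k0 fk; exists k, 1; split => //; first by rewrite ltr01 lexx.
by move=> x y; rewrite powRr1// mdist_ge0.
Qed.

Lemma capped_dist_continuous A : continuous (capped_dist A).
Proof.
apply: (@lipschitz_continuous _ 1) => // x y.
by rewrite mul1r capped_dist_lipschitz.
Qed.

Lemma metric_bounded_sub A B : A `<=` B -> metric_bounded B -> metric_bounded A.
Proof. by move=> AB [M BM]; exists M => x y /AB ? /AB; exact: BM. Qed.

Lemma metric_bounded_thickening A : metric_bounded A ->
  metric_bounded [set x | capped_dist A x < 1].
Proof.
move=> [M AM]; exists (1 + M + 1) => x y.
move=> /capped_dist_lt[//|a Aa xa] /capped_dist_lt[//|b Ab yb].
rewrite (le_trans (metric_triangle _ b _))// lerD//; last first.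
  by rewrite metric_sym ltW.
by rewrite (le_trans (metric_triangle _ a _))// lerD ?(ltW xa)// AM.
Qed.

Lemma metric_bounded_closure A : metric_bounded A -> metric_bounded (closure A).
Proof.
move=> /metric_bounded_thickening; apply: metric_bounded_sub => x clAx /=.
have [a [Aa]] := clAx _ (nbhsx_ballx x 1 ltr01).
by rewrite ballEmdist; apply: le_lt_trans; exact: capped_dist_le.
Qed.

Lemma compact_metric_bounded A : compact A -> metric_bounded A.
Proof.
have [->|/set0P[p Ap] cA] := eqVneq A set0; first by exists 0 => ? ? [].
have pc : continuous (mdist p).
  apply: (@lipschitz_continuous _ 1) => // x y; rewrite mul1r.
  rewrite ler_norml lerBlDl lerNl opprB lerBlDl metric_triangle.
  by rewrite (metric_sym x y) metric_triangle.
have /compact_bounded[M [_ Mb]] : compact (mdist p @` A).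
  by apply: continuous_compact => //; exact: continuous_subspaceT.
have pM a : A a -> mdist p a <= M + 1.
  move=> Aa; rewrite (le_trans (ler_norm _))//.
  by apply: (Mb (M + 1)); [rewrite ltrDl|exists a].
exists (M + 1 + (M + 1)) => x y /pM px /pM py.
by rewrite (le_trans (metric_triangle _ p _))// lerD// metric_sym.
Qed.

Definition ramp k A x : R := Num.min 1 (k * capped_dist A x).

Lemma ramp_ge0 k A x : 0 <= k -> 0 <= ramp k A x.
Proof. by move=> k0; rewrite le_min ler01 mulr_ge0// capped_dist_ge0. Qed.

Lemma ramp_le1 k A x : ramp k A x <= 1.
Proof. by rewrite ge_min lexx. Qed.

Lemma ramp0 k A x : A x -> ramp k A x = 0.
Proof. by move=> Ax; rewrite /ramp capped_dist0// mulr0; apply: min_r. Qed.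

Lemma ramp_lipschitz k A x y : 0 <= k ->
  `|ramp k A x - ramp k A y| <= k * mdist x y.
Proof.
move=> k0; wlog suff h : x y / ramp k A x - ramp k A y <= k * mdist x y.
  by rewrite ler_norml h lerNl opprB metric_sym h.
rewrite lerBlDr {2}/ramp minEle; case: ifPn => _.
  by rewrite ler_wpDl ?ramp_le1 ?mulr_ge0 ?mdist_ge0.
rewrite -mulrDr ge_min; apply/orP; right; rewrite ler_wpM2l//.
by rewrite -lerBlDr (le_trans (ler_norm _))// capped_dist_lipschitz.
Qed.

Lemma ramp_eq1 k A x : 2 <= k -> 1 <= capped_dist A x -> ramp k A x = 1.
Proof.
move=> k2 d1; apply: min_l; rewrite (le_trans d1)// ler_peMl ?capped_dist_ge0//.
by rewrite (le_trans _ k2)// ler1n.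
Qed.

Lemma cvg_ramp A x : closed A ->
  ramp n%:R A x @[n --> \oo] --> (\1_(~` A) x : R).
Proof.
move=> cA; have [Ax|nAx] := pselect (A x).
  rewrite indicE memNset; last by rewrite /= notK.
  by under eq_fun do rewrite ramp0//; exact: cvg_cst.
rewrite indicE mem_set//; apply: cvg_near_cst; near=> n.
apply: min_l; rewrite -ler_pdivrMr ?capped_dist_gt0// div1r.
by near: n; exact: nbhs_infty_ger.
Unshelve. all: by end_near. Qed.

End capped_distance.

Section limn_esup_einf_real_bounds.
Context {R : realType}.
Implicit Types (u v : nat -> \bar R) (l : R).

Lemma limn_esup_leP u l : limn_esup u <= l%:E <->
  forall e : R, (0 < e)%R -> \forall n \near \oo, u n <= (l + e)%:E.
Proof.
split=> [ul e e0|ul].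
  have : limn_esup u < (l + e)%:E by rewrite (le_lt_trans ul)// lte_fin ltrDl.
  move=> /ereal_inf_lt[_ [V nV <-] Vle]; near=> n.
  rewrite (le_trans _ (ltW Vle))//; apply: ereal_sup_ubound; exists n => //.
  by near: n.
apply/lee_addgt0Pr => e /ul ule; rewrite -EFinD.
apply: (@le_trans _ _ (ereal_sup (u @` [set n | u n <= (l + e)%:E]))).
  by apply: ereal_inf_lbound; exists [set n | u n <= (l + e)%:E].
by apply: ge_ereal_sup => _ [n /= ? <-].
Unshelve. all: by end_near. Qed.

Lemma limn_einf_geP u l : l%:E <= limn_einf u <->
  forall e : R, (0 < e)%R -> \forall n \near \oo, (l - e)%:E <= u n.
Proof.
rewrite /limn_einf leeNr; rewrite -EFinN limn_esup_leP.
by split=> ul e /ul; apply: filterS => n; rewrite leeNl -EFinN opprD opprK.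
Qed.

Lemma le_limn_esup u v : (forall n, u n <= v n) -> limn_esup u <= limn_esup v.
Proof.
move=> uv; rewrite !limn_esup_lim; apply: lee_lim.
- exact: is_cvg_esups.
- exact: is_cvg_esups.
- apply: nearW => n; apply: ge_ereal_sup => _ [m /= nm <-].
  by rewrite (le_trans (uv m))//; apply: ereal_sup_ubound; exists m.
Qed.

Lemma le_limn_einf u v : (forall n, u n <= v n) -> limn_einf u <= limn_einf v.
Proof. by move=> uv; rewrite leeN2; apply: le_limn_esup => n; rewrite leeN2. Qed.

Lemma limn_einf_esup_cvg u (l : \bar R) :
  l <= limn_einf u -> limn_esup u <= l -> u @ \oo --> l.
Proof.
move=> li sl; have il : limn_einf u = l.
  by apply/eqP; rewrite eq_le li (le_trans (limn_einf_sup u)).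
have -> : l = limn_esup u.
  by apply/eqP; rewrite eq_le sl (le_trans li (limn_einf_sup u)).
apply: (@squeeze_cvge _ _ _ _ (einfs u) _ (esups u)).
- apply: nearW => n; apply/andP; split.
    by apply: ereal_inf_lbound; exists n => /=.
  by apply: ereal_sup_ubound; exists n => /=.
- have -> : limn_esup u = limn_einf u.
    by apply/eqP; rewrite eq_le limn_einf_sup il sl.
  by rewrite limn_einf_lim; exact: is_cvg_einfs.
- by rewrite limn_esup_lim; exact: is_cvg_esups.
Qed.

Lemma limn_esup_le_sum N (u : nat -> nat -> \bar R) (l : nat -> R) :
  (forall i, (i < N)%N -> limn_esup (u i) <= (l i)%:E) ->
  limn_esup (fun n => \sum_(i < N) u i n) <= (\sum_(i < N) l i)%:E.
Proof.
move=> ul; apply/limn_esup_leP => e e0.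
have eN0 : (0 < e / N.+1%:R)%R by rewrite divr_gt0.
have : \forall n \near \oo, forall i : 'I_N, u i n <= (l i + e / N.+1%:R)%:E.
  by apply: filter_forall => i; apply: (limn_esup_leP _ _).1 => //; exact: ul.
apply: filterS => n un.
apply: (@le_trans _ _ (\sum_(i < N) (l i + e / N.+1%:R)%:E)).
  exact: lee_sum.
rewrite sumEFin lee_fin big_split/= lerD2l sumr_const card_ord -mulrnAr.
rewrite -[leRHS]mulr1 ler_wpM2l ?(ltW e0)// -[leLHS]mulr_natl.
by rewrite ler_pdivrMr ?mul1r ?ler_nat.
Qed.

Lemma limn_einf_ge_sum N (u : nat -> nat -> \bar R) (l : nat -> R) :
  (forall i, (i < N)%N -> (l i)%:E <= limn_einf (u i)) ->
  (\sum_(i < N) l i)%:E <= limn_einf (fun n => \sum_(i < N) u i n).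
Proof.
move=> ul; apply/limn_einf_geP => e e0.
have eN0 : (0 < e / N.+1%:R)%R by rewrite divr_gt0.
have : \forall n \near \oo, forall i : 'I_N, (l i - e / N.+1%:R)%:E <= u i n.
  by apply: filter_forall => i; apply: (limn_einf_geP _ _).1 => //; exact: ul.
apply: filterS => n un.
apply: (@le_trans _ _ (\sum_(i < N) (l i - e / N.+1%:R)%:E)).
  rewrite sumEFin lee_fin sumrB lerB// sumr_const card_ord -mulrnAr.
  rewrite -[leRHS]mulr1 ler_wpM2l ?(ltW e0)// -[leLHS]mulr_natl.
  by rewrite ler_pdivrMr ?mul1r ?ler_nat.
exact: lee_sum.
Qed.

Lemma limn_esup_leZ u l (c : R) : (0 < c)%R -> limn_esup u <= l%:E ->
  limn_esup (fun n => c%:E * u n) <= (c * l)%:E.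
Proof.
move=> c0 /limn_esup_leP ul; apply/limn_esup_leP => e e0.
have /ul := divr_gt0 e0 c0; apply: filterS => n un.
apply: (@le_trans _ _ (c%:E * (l + e / c)%:E)); first by rewrite lee_pmul2l.
by rewrite -EFinM mulrDr mulrCA divff ?mulr1 ?gt_eqF.
Qed.

Lemma limn_einf_geZ u l (c : R) : (0 < c)%R -> l%:E <= limn_einf u ->
  (c * l)%:E <= limn_einf (fun n => c%:E * u n).
Proof.
move=> c0 /limn_einf_geP ul; apply/limn_einf_geP => e e0.
have /ul := divr_gt0 e0 c0; apply: filterS => n un.
apply: (@le_trans _ _ (c%:E * (l - e / c)%:E)); last by rewrite lee_pmul2l.
by rewrite -EFinM mulrBr mulrCA divff ?mulr1 ?gt_eqF.
Qed.

End limn_esup_einf_real_bounds.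

Section oscillation.
Local Open Scope ring_scope.
Context {R : realType} {T : topologicalType}.
Implicit Types (f : T -> R) (e c : R).

Definition small_oscillation f e : set T :=
  [set x | exists2 U, nbhs x U & forall y z, U y -> U z -> `|f y - f z| < e].

Lemma open_small_oscillation f e : open (small_oscillation f e).
Proof.
rewrite openE => x [U /nbhs_interior xU Ue].
by apply: filterS xU => y yU; exists U.
Qed.

(* Exhibits the discontinuity set of an arbitrary function as an F_sigma set,
   hence as a Borel set. *)
Lemma discontinuity_setE f :
  discontinuity_set f = \bigcup_k ~` small_oscillation f k.+1%:R^-1.
Proof.
apply/seteqP; split=> [x|x [k _ osc] fx]; last first.
  apply: osc; have k0 : 0 < k.+1%:R^-1 / 2 :> R by rewrite divr_gt0.
  exists [set y | `|f x - f y| < k.+1%:R^-1 / 2].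
    by have /cvgrPdist_lt := fx; exact.
  move=> y z /= xy xz; rewrite (splitr k.+1%:R^-1).
  rewrite (le_lt_trans (ler_distD (f x) _ _))// ltrD//.
  by rewrite distrC.
apply: contra_notP => /= osc; apply/cvgrPdist_lt => e e0.
have [k ke] : exists k, k.+1%:R^-1 < e.
  by have [k] := ltr_add_invr e0; rewrite add0r => ke; exists k.
have [U xU Uk] : small_oscillation f k.+1%:R^-1 x.
  by apply: contrapT => nosc; apply: osc; exists k.
apply: filterS (xU) => y Uy; rewrite (lt_trans _ ke)// Uk//.
exact: nbhs_singleton xU.
Qed.

Lemma superlevel_sub_interior f c :
  [set x | c < f x] `<=` [set x | c <= f x]° `|` discontinuity_set f.
Proof.
move=> x /= cx; have [fx|] := pselect {for x, continuous f}; last by right.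
by left; apply: (filterS _ (cvgr_gt _ fx _ cx)) => y /ltW.
Qed.

Lemma closure_superlevel_sub f c :
  closure [set x | c < f x] `<=` [set x | c <= f x] `|` discontinuity_set f.
Proof.
move=> x clx; have [fx|] := pselect {for x, continuous f}; last by right.
left; rewrite /= leNgt; apply/negP => xc.
have [y [/= cy yc]] := clx _ (cvgr_lt _ fx _ xc).
by move: (lt_trans cy yc); rewrite ltxx.
Qed.

End oscillation.

Lemma measurable_preimageT {d d'} {T : measurableType d}
  {T' : measurableType d'} (f : T -> T') (Y : set T') :
  measurable_fun setT f -> measurable Y -> measurable (f @^-1` Y).
Proof. by move=> mf mY; rewrite -[X in measurable X]setTI; exact: mf. Qed.

Section finite_measure.
Context {d} {T : measurableType d} {R : realType}.
Variable mu : {finite_measure set T -> \bar R}.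

Lemma finite_measureE A : measurable A -> mu A = (fine (mu A))%:E.
Proof. by move=> mA; rewrite fineK// fin_num_measure. Qed.

Lemma exists_null_level (g : T -> R) (a b : R) : measurable_fun setT g ->
  (a < b)%R -> exists2 t, (a < t < b)%R & mu (g @^-1` [set t]) = 0.
Proof.
move=> mg ab.
have mlevel t : measurable (g @^-1` [set t]) by exact: measurable_preimageT.
have [mu0|mu_neq0] := eqVneq (mu setT) 0.
  exists ((a + b) / 2)%R; first by rewrite midf_lt//= midf_lt.
  by apply/eqP; rewrite -measure_le0 -mu0 le_measure ?inE.
pose P : probability T R := mnormalize mu (dirac point).
pose G : {RV P >-> R} := mfun_Sub (mem_set mg).
have : ~ `]a, b[ `<=` [set t | (0 < pmf G t)%R].
  move=> /subset_card_le/sub_countable/(_ (pmf_gt0_countable G)).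
  move=> /countable_lebesgue_measure0.
  rewrite lebesgue_measure_itv/= lte_fin ab => /eqP.
  by rewrite -EFinB eqe subr_eq0 gt_eqF.
move=> /existsNP[t /not_implyP[]].
rewrite /= in_itv/= => atb /negP; rewrite -leNgt => Pt.
exists t => //; move: Pt; rewrite /pmf /= /mnormalize.
rewrite (negbTE mu_neq0) (lt_eqF (fin_num_fun_lty (fin_num_measure mu)))/=.
rewrite finite_measureE// -EFinM/= pmulr_lle0; last first.
  by rewrite invr_gt0 fine_gt0// lt0e mu_neq0 measure_ge0 ltey_eq fin_num_measure.
by move=> le0; congr EFin; apply/eqP; rewrite eq_le le0 fine_ge0.
Qed.

Lemma le_measure_null A B N : measurable A -> measurable B -> measurable N ->
  mu N = 0 -> A `<=` B `|` N -> mu A <= mu B.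
Proof.
move=> mA mB mN N0 ABN; rewrite -[leRHS]adde0 -N0.
rewrite (@le_trans _ _ (mu (B `|` N)))//.
  by rewrite le_measure ?inE//; exact: measurableU.
exact: measureU2.
Qed.

Lemma bounded_integrable (f : T -> R) : measurable_fun setT f ->
  bounded_fun f -> mu.-integrable setT (EFin \o f).
Proof.
move=> mf bf; apply: measurable_bounded_integrable => //.
by rewrite ltey_eq fin_num_measure.
Qed.

End finite_measure.

Section borel_sets.
Context {R : realType} {X : completeMetricType R}.
Implicit Types (A : set X) (f : X -> R).

Lemma borel_open A : open A -> (@open X).-sigma.-measurable A.
Proof. exact: sub_sigma_algebra. Qed.

Lemma borel_closed A : closed A -> (@open X).-sigma.-measurable A.
Proof.
by move=> /closed_openC/borel_open/measurableC; rewrite setCK.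
Qed.

Lemma borel_continuous f : continuous f -> measurable_fun [set: borel X] f.
Proof.
move=> /continuousP cf; apply: (measurability _ (RGenOpens.measurableE R)).
move=> _ [_ [a [b ->] <-]]; rewrite setTI; apply: borel_open.
exact/cf/interval_open.
Qed.

Lemma borel_discontinuity_set f :
  (@open X).-sigma.-measurable (discontinuity_set f).
Proof.
rewrite discontinuity_setE; apply: bigcupT_measurable => k; apply: borel_closed.
exact/open_closedC/open_small_oscillation.
Qed.

Lemma borel_boundary A : (@open X).-sigma.-measurable (boundary A).
Proof.
apply: measurableD; first by apply: borel_closed; exact: closed_closure.
by apply: borel_open; exact: open_interior.
Qed.

End borel_sets.

Section portmanteau.
Context {R : realType} {X : completeMetricType R}.
Implicit Types (A B : set X) (f g : X -> R).
Local Notation finmeas := {finite_measure set (borel X) -> \bar R}.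

Lemma bounded_support_Cc f : Heine_Borel_space X -> continuous f ->
  metric_bounded [set x | (f x != 0)%R] -> Cc f.
Proof.
move=> hbX cf bf; split=> //; apply: hbX; first exact: closed_closure.
exact: metric_bounded_closure.
Qed.

Lemma cvg_integral_indic (mu : finmeas) (f_ : nat -> X -> R) B :
  (@open X).-sigma.-measurable B -> (forall n, continuous (f_ n)) ->
  (forall n x, (0 <= f_ n x <= 1)%R) ->
  (forall x, (f_ n x @[n --> \oo] --> (\1_B x : R))%R) ->
  \int[mu]_x (f_ n x)%:E @[n --> \oo] --> mu B.
Proof.
move=> mB cf f01 fB; rewrite -[mu B](_ : \int[mu]_x (\1_B x)%:E = _); last first.
  by rewrite integral_indic// setIT.
have [] // := @dominated_convergence _ (borel X) R mu setT measurableT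
  (fun n x => (f_ n x)%:E) (fun x => (\1_B x)%:E) (cst 1).
- by move=> n; apply/measurable_EFinP; exact: borel_continuous.
- by apply/measurable_EFinP; exact: measurable_indic.
- by apply: aeW => x _; apply/cvg_EFin; [exact: nearW|exact: fB].
- apply: (@bounded_integrable _ (borel X) R mu (cst 1%R)) => //.
  by apply: bounded_cst.
- apply: aeW => x n _; rewrite lee_fin ger0_norm; by case/andP: (f01 n x).
Qed.

Section convergence.
Variables (nu_ : nat -> finmeas) (nu : finmeas).

(* The two halves of condition (III). *)
Definition limsup_closed : Prop := forall A, metric_bounded A -> closed A ->
  limn_esup (fun n => nu_ n A) <= nu A.

Definition liminf_open : Prop := forall B, metric_bounded B -> open B ->
  nu B <= limn_einf (fun n => nu_ n B).

(* Condition (VII). *)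
Definition hoelder_cvg : Prop := forall f, Cc f -> hoelder_continuous f ->
  integral_cvg nu_ nu f.

Lemma hoelder_limsup_closed :
  Heine_Borel_space X -> hoelder_cvg -> limsup_closed.
Proof.
move=> hbX hcvg A bA cA.
pose h k x : R := (1 - ramp (k + 2)%:R A x)%R.
have hlip k x y : (`|h k x - h k y| <= (k + 2)%:R * mdist x y)%R.
  by rewrite /h distrC opprB addrC addrA subrK ramp_lipschitz.
have h01 k x : (0 <= h k x <= 1)%R.
  by rewrite /h subr_ge0 ramp_le1 gerBl ramp_ge0.
have hA k x : A x -> h k x = 1%R by move=> Ax; rewrite /h ramp0// subr0.
have ch k : continuous (h k) by exact: lipschitz_continuous (hlip k).
have Cch k : Cc (h k).
  apply: bounded_support_Cc => //.
  apply: metric_bounded_sub (metric_bounded_thickening A bA) => x /=.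
  apply: contraNT; rewrite -leNgt => d1.
  by rewrite /h ramp_eq1 ?subrr// ler_nat leq_addl.
have hcvgA : \int[nu]_x (h k x)%:E @[k --> \oo] --> nu A.
  apply: cvg_integral_indic => //; first exact: borel_closed.
  move=> x; rewrite -[A in \1_A]setCK.
  rewrite (_ : \1_(~` ~` A) x = 1 - \1_(~` A) x)%R; last first.
    by rewrite !indicE in_setC; case: (x \in _); rewrite /= ?subrr ?subr0.
  apply: cvgB; first exact: cvg_cst.
  by have := cvg_ramp A x cA; rewrite -(cvg_shiftn 2).
rewrite -(cvg_lim _ hcvgA)//; apply: lime_ge; first by apply/cvg_ex; exists (nu A).
apply: nearW => k.
rewrite -(cvg_limn_einf_sup (hcvg _ (Cch k) (lipschitz_hoelder _ _ _ (hlip k)))).2//.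
apply: le_limn_esup => n; rewrite -[A in nu_ n A]setIT.
rewrite -integral_indic//; last exact: borel_closed.
apply: ge0_le_integral => //.
- by apply/measurable_EFinP; apply: measurable_indic; exact: borel_closed.
- by apply/measurable_EFinP; exact: borel_continuous.
- move=> x _; rewrite lee_fin indicE.
  have [/set_mem Ax|_] := boolP (x \in A); first by rewrite hA.
  by case/andP: (h01 k x).
Qed.

Lemma hoelder_liminf_open :
  Heine_Borel_space X -> hoelder_cvg -> liminf_open.
Proof.
move=> hbX hcvg B bB oB.
have cB : closed (~` B) by exact: open_closedC.
pose g k := ramp (k%:R : R) (~` B).
have glip k x y : (`|g k x - g k y| <= k%:R * mdist x y)%R.
  exact: ramp_lipschitz.
have g01 k x : (0 <= g k x <= 1)%R by rewrite ramp_ge0// ramp_le1.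
have gB k x : (g k x != 0)%R -> B x.
  by apply: contra_neqP => nBx; rewrite /g ramp0.
have cg k : continuous (g k) by exact: lipschitz_continuous (glip k).
have Ccg k : Cc (g k).
  by apply: bounded_support_Cc => //; apply: metric_bounded_sub bB => x /gB.
have gcvg : \int[nu]_x (g k x)%:E @[k --> \oo] --> nu B.
  apply: cvg_integral_indic => //; first exact: borel_open.
  by move=> x; rewrite -[B in \1_B]setCK; exact: cvg_ramp.
rewrite -(cvg_lim _ gcvg)//; apply: lime_le; first by apply/cvg_ex; exists (nu B).
apply: nearW => k.
rewrite -(cvg_limn_einf_sup (hcvg _ (Ccg k) (lipschitz_hoelder _ _ _ (glip k)))).1//.
apply: le_limn_einf => n; rewrite -[B in nu_ n B]setIT.
rewrite -integral_indic//; last exact: borel_open.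
apply: ge0_le_integral => //.
- by move=> x _; rewrite lee_fin; case/andP: (g01 k x).
- by apply/measurable_EFinP; exact: borel_continuous.
- by apply/measurable_EFinP; apply: measurable_indic; exact: borel_open.
- move=> x _; rewrite lee_fin indicE.
  have [_|nxB] := boolP (x \in B); first by case/andP: (g01 k x).
  by rewrite leNgt; apply: contra nxB => /lt0r_neq0/gB/mem_set.
Qed.

End convergence.
End portmanteau.

Section layers.
Local Open Scope ring_scope.
Context {R : realType}.
Implicit Types (y e : R) (N : nat).

Lemma sum_layers_le N y e : 0 <= y -> 0 < e ->
  e * (\sum_(i < N) (i.+1%:R * e <= y)%R%:R) <= y.
Proof.
move=> y0 e0; suff : e * (\sum_(i < N) (i.+1%:R * e <= y)%R%:R) <=
    Num.min y (N%:R * e) by rewrite le_min => /andP[].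
elim: N => [|N IH]; first by rewrite big_ord0 mulr0 mul0r le_min y0 lexx.
rewrite big_ord_recr mulrDr/=; have [Ny|yN] := leP (N.+1%:R * e) y.
  rewrite mulr1 -natr1 mulrDl mul1r lerD2r.
  by rewrite (le_trans IH)// ge_min lexx orbT.
by rewrite mulr0 addr0 (le_trans IH)// ge_min lexx.
Qed.

Lemma le_sum_layers N y e : 0 <= y -> 0 < e -> y <= N%:R * e ->
  y <= e * (\sum_(i < N) (i%:R * e < y)%R%:R).
Proof.
move=> y0 e0 yN; have {1}-> : y = Num.min y (N%:R * e).
  by apply/esym/min_l.
elim: N {yN} => [|N IH]; first by rewrite big_ord0 mulr0 mul0r ge_min lexx orbT.
rewrite big_ord_recr mulrDr/=; have [Ny|yN] := ltP (N%:R * e) y.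
  rewrite mulr1 -natr1 mulrDl mul1r ge_min; apply/orP; right; rewrite lerD2r.
  by rewrite (le_trans _ IH)// le_min lexx ltW.
rewrite mulr0 addr0 (le_trans _ IH)// le_min ge_min lexx/=.
by rewrite ge_min yN.
Qed.

End layers.

Section integral_layers.
Context {d} {T : measurableType d} {R : realType}.
Variable mu : {measure set T -> \bar R}.

Lemma integral_sum_indic N (e : R) (A : nat -> set T) : (0 <= e)%R ->
  (forall i, measurable (A i)) ->
  \int[mu]_x (e * \sum_(i < N) \1_(A i) x)%:E = e%:E * \sum_(i < N) mu (A i).
Proof.
move=> e0 mA.
under eq_integral do rewrite EFinM -sumEFin.
rewrite ge0_integralZl_EFin//; first last.
- apply: emeasurable_sum => i; apply/measurable_EFinP; exact: measurable_indic.
- by move=> x _; apply: sume_ge0 => i _; rewrite lee_fin.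
rewrite ge0_integral_sum//.
  by congr (_ * _); apply: eq_bigr => i _; rewrite integral_indic// setIT.
- by move=> i; apply/measurable_EFinP; exact: measurable_indic.
Qed.

Variables (f : T -> R) (e : R).
Hypotheses (mf : measurable_fun setT f) (f0 : forall x, (0 <= f x)%R).
Hypothesis e0 : (0 < e)%R.

Lemma measurable_superlevel (c : R) : measurable [set x | (c < f x)%R].
Proof.
have -> : [set x | (c < f x)%R] = f @^-1` `]c, +oo[%classic.
  by apply/seteqP; split=> x /=; rewrite in_itv/= andbT.
exact: measurable_preimageT.
Qed.

Lemma measurable_superlevel_le (c : R) : measurable [set x | (c <= f x)%R].
Proof.
have -> : [set x | (c <= f x)%R] = f @^-1` `[c, +oo[%classic.
  by apply/seteqP; split=> x /=; rewrite in_itv/= andbT.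
exact: measurable_preimageT.
Qed.

Lemma layers_le_integral N :
  e%:E * \sum_(i < N) mu [set x | (i.+1%:R * e <= f x)%R] <=
  \int[mu]_x (f x)%:E.
Proof.
rewrite -(integral_sum_indic N e (fun i => [set x | (i.+1%:R * e <= f x)%R]) (ltW e0)).
  apply: ge0_le_integral => //.
  - by move=> x _; rewrite lee_fin mulr_ge0 ?(ltW e0)// sumr_ge0.
  - apply/measurable_EFinP/measurable_funM => //; apply: measurable_sum => i.
    exact/measurable_indic/measurable_superlevel_le.
  - exact/measurable_EFinP.
  - move=> x _; rewrite lee_fin.
    under eq_bigr do rewrite indicE mem_setE.
    exact: sum_layers_le.
by move=> i; exact: measurable_superlevel_le.
Qed.

Lemma integral_le_layers N : (forall x, (f x <= N%:R * e)%R) ->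
  \int[mu]_x (f x)%:E <=
  e%:E * \sum_(i < N) mu [set x | (i%:R * e < f x)%R].
Proof.
move=> fN.
rewrite -(integral_sum_indic N e (fun i => [set x | (i%:R * e < f x)%R]) (ltW e0)).
  apply: ge0_le_integral => //.
  - by move=> x _; rewrite lee_fin.
  - exact/measurable_EFinP.
  - apply/measurable_EFinP/measurable_funM => //; apply: measurable_sum => i.
    exact/measurable_indic/measurable_superlevel.
  - move=> x _; rewrite lee_fin.
    under eq_bigr do rewrite indicE mem_setE.
    exact: le_sum_layers.
by move=> i; exact: measurable_superlevel.
Qed.

End integral_layers.

Section implications.
Context {R : realType} {X : completeMetricType R}.
Local Notation finmeas := {finite_measure set (borel X) -> \bar R}.
Variables (nu_ : nat -> finmeas) (nu : finmeas).
Implicit Types (A B : set X) (f g : X -> R).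

(* Condition (IV). *)
Definition interior_closure_bounds : Prop :=
  forall A, metric_bounded A -> (@open X).-sigma.-measurable A ->
    [/\ nu A° <= limn_einf (fun n => nu_ n A),
        limn_einf (fun n => nu_ n A) <= limn_esup (fun n => nu_ n A) &
        limn_esup (fun n => nu_ n A) <= nu (closure A)].

(* Condition (V). *)
Definition continuity_set_cvg : Prop :=
  forall A, metric_bounded A -> (@open X).-sigma.-measurable A ->
    continuity_set nu A -> nu_ n A @[n --> \oo] --> nu A.

Lemma limsup_liminf_interior_closure :
  limsup_closed nu_ nu -> liminf_open nu_ nu -> interior_closure_bounds.
Proof.
move=> lsup linf A bA mA; split.
- have bi := metric_bounded_sub _ _ (@interior_subset _ A) bA.
  rewrite (le_trans (linf _ bi (@open_interior _ A)))//; apply: le_limn_einf => n.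
  rewrite le_measure ?inE//; first by apply: borel_open; exact: open_interior.
  exact: interior_subset.
- exact: limn_einf_sup.
- have bc := metric_bounded_closure _ bA.
  rewrite (le_trans _ (lsup _ bc (@closed_closure _ A)))//; apply: le_limn_esup => n.
  rewrite le_measure ?inE//; first by apply: borel_closed; exact: closed_closure.
  exact: subset_closure.
Qed.

Lemma interior_closure_continuity_set :
  interior_closure_bounds -> continuity_set_cvg.
Proof.
move=> icb A bA mA nuA0; have [iA _ cA] := icb A bA mA.
have mi : (@open X).-sigma.-measurable A° by apply: borel_open; exact: open_interior.
have mc : (@open X).-sigma.-measurable (closure A).
  by apply: borel_closed; exact: closed_closure.
have nu_ci : nu (closure A) <= nu A°.
  apply: (le_measure_null nu _ _ (boundary A)) => //; first exact: borel_boundary.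
  rewrite /boundary setDUK//.
  exact: subset_trans (@interior_subset _ A) (@subset_closure _ A).
apply: limn_einf_esup_cvg.
  rewrite (le_trans _ iA)// (le_trans _ nu_ci)// le_measure ?inE//.
  exact: subset_closure.
rewrite (le_trans cA)// (le_trans nu_ci)// le_measure ?inE//.
exact: interior_subset.
Qed.

Lemma continuous_open_lt g t : continuous g -> open [set x | (g x < t)%R].
Proof. by move=> cg; apply: open_comp (@open_lt _ t) => x _; exact: cg. Qed.

Lemma continuous_open_gt g t : continuous g -> open [set x | (t < g x)%R].
Proof. by move=> cg; apply: open_comp (@open_gt _ t) => x _; exact: cg. Qed.

Lemma continuous_closed_le g t : continuous g -> closed [set x | (g x <= t)%R].
Proof. by move=> cg; apply: closed_comp (@closed_le _ t) => x _; exact: cg. Qed.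

Lemma continuous_closed_ge g t : continuous g -> closed [set x | (t <= g x)%R].
Proof. by move=> cg; apply: closed_comp (@closed_ge _ t) => x _; exact: cg. Qed.

Lemma null_level_continuity_sets g t : continuous g ->
  nu (g @^-1` [set t]) = 0 ->
  continuity_set nu [set x | (g x < t)%R] /\
  continuity_set nu [set x | (t < g x)%R].
Proof.
move=> cg nut.
have mt : (@open X).-sigma.-measurable (g @^-1` [set t]).
  by apply: measurable_preimageT => //; exact: borel_continuous.
have null B : boundary B `<=` g @^-1` [set t] -> continuity_set nu B.
  move=> Bt; apply/eqP; rewrite -measure_le0 -nut le_measure ?inE//.
  exact: borel_boundary.
split; apply: null => x [clx].
- rewrite (interior_id _).1; last exact: continuous_open_lt.
  move=> /negP; rewrite -leNgt => tx; apply/eqP; rewrite eq_le tx andbT.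
  apply: (continuous_closed_le g t cg); apply: closureS clx => y /=.
  exact: ltW.
- rewrite (interior_id _).1; last exact: continuous_open_gt.
  move=> /negP; rewrite -leNgt => tx; apply/eqP; rewrite eq_le tx /=.
  apply: (continuous_closed_ge g t cg); apply: closureS clx => y /=.
  exact: ltW.
Qed.

Lemma continuity_set_limsup_closed :
  continuity_set_cvg -> limsup_closed nu_ nu.
Proof.
(* The thickenings {g < t} are continuity sets for all but countably many t. *)
move=> csc A bA cA.
pose g := capped_dist A; have cg : continuous g by exact: capped_dist_continuous.
pose U k := [set x | (g x < k.+1%:R^-1)%R].
have oU k : open (U k) by exact: continuous_open_lt.
have UA : \bigcap_k U k = A.
  apply/seteqP; split=> [x Ux|x Ax k _].
    apply: contrapT => /(capped_dist_gt0 _ _ cA)/ltr_add_invr[k].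
    by rewrite add0r => /(lt_trans (Ux k I)); rewrite ltxx.
  by rewrite /U /= /g capped_dist0// invr_gt0.
have cvgU : nu (U k) @[k --> \oo] --> nu A.
  rewrite -UA; apply: nonincreasing_cvg_mu => //.
  - by rewrite ltey_eq fin_num_measure//; exact: borel_open.
  - by move=> k; exact: borel_open.
  - by rewrite UA; exact: borel_closed.
  - move=> m n mn; apply/subsetPset => x /= /lt_le_trans; apply.
    by rewrite lef_pV2 ?posrE// ler_nat ltnS.
rewrite -(cvg_lim _ cvgU)//; apply: lime_ge; first by apply/cvg_ex; exists (nu A).
apply: nearW => k.
have [t /andP[t0 tk] nut] : exists2 t, (0 < t < k.+1%:R^-1)%R &
    nu (g @^-1` [set t]) = 0.
  by apply: exists_null_level; rewrite ?invr_gt0//; exact: borel_continuous.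
pose V := [set x | (g x < t)%R].
have VU : V `<=` U k by move=> x /lt_trans; exact.
have bV : metric_bounded V.
  apply: metric_bounded_sub (metric_bounded_thickening A bA) => x /= xt.
  by rewrite (lt_trans xt)// (lt_le_trans tk)// invf_le1 ?ler1n.
have mV : (@open X).-sigma.-measurable V.
  by apply: borel_open; exact: continuous_open_lt.
have Vcvg := csc V bV mV (null_level_continuity_sets g t cg nut).1.
rewrite (@le_trans _ _ (nu V))//; last first.
  by rewrite le_measure ?inE//; exact: borel_open.
rewrite -(cvg_limn_einf_sup Vcvg).2; apply: le_limn_esup => n.
rewrite le_measure ?inE//; first exact: borel_closed.
by move=> x Ax; rewrite /V /= /g capped_dist0.
Qed.

Lemma continuity_set_liminf_open :
  continuity_set_cvg -> liminf_open nu_ nu.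
Proof.
move=> csc B bB oB; have cB : closed (~` B) by exact: open_closedC.
pose g := capped_dist (~` B).
have cg : continuous g by exact: capped_dist_continuous.
have gB x : (0 < g x)%R -> B x.
  by apply: contraPP => nBx; rewrite /g capped_dist0// ltxx.
pose U k := [set x | (k.+1%:R^-1 < g x)%R].
have oU k : open (U k) by exact: continuous_open_gt.
have UB : \bigcup_k U k = B.
  apply/seteqP; split=> [x [k _ Ux]|x Bx].
    by apply: gB; apply: lt_trans Ux; rewrite invr_gt0.
  have : (0 < g x)%R by apply: capped_dist_gt0 => //; rewrite /= notK.
  by move=> /ltr_add_invr[k]; rewrite add0r => kx; exists k.
have cvgU : nu (U k) @[k --> \oo] --> nu B.
  rewrite -UB; apply: nondecreasing_cvg_mu => //.
  - by move=> k; exact: borel_open.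
  - by rewrite UB; exact: borel_open.
  - move=> m n mn; apply/subsetPset => x /=; apply: le_lt_trans.
    by rewrite lef_pV2 ?posrE// ler_nat ltnS.
rewrite -(cvg_lim _ cvgU)//; apply: lime_le; first by apply/cvg_ex; exists (nu B).
apply: nearW => k.
have [t /andP[t0 tk] nut] : exists2 t, (0 < t < k.+1%:R^-1)%R &
    nu (g @^-1` [set t]) = 0.
  by apply: exists_null_level; rewrite ?invr_gt0//; exact: borel_continuous.
pose V := [set x | (t < g x)%R].
have UV : U k `<=` V by move=> x; exact: lt_trans.
have VB : V `<=` B by move=> x /(lt_trans t0); exact: gB.
have mV : (@open X).-sigma.-measurable V.
  by apply: borel_open; exact: continuous_open_gt.
have Vcvg := csc V (metric_bounded_sub _ _ VB bB) mV
  (null_level_continuity_sets g t cg nut).2.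
rewrite (@le_trans _ _ (nu V))//.
  by rewrite le_measure ?inE//; exact: borel_open.
rewrite -(cvg_limn_einf_sup Vcvg).1; apply: le_limn_einf => n.
by rewrite le_measure ?inE//; exact: borel_open.
Qed.

End implications.

Section integrals.
Context {R : realType} {X : completeMetricType R}.
Local Notation finmeas := {finite_measure set (borel X) -> \bar R}.
Variables (nu_ : nat -> finmeas) (nu : finmeas).
Implicit Types (A B : set X) (f g : X -> R).

(* Layer by layer, the superlevel sets {c < f} have closures inside {c <= f}
   and the sets {c <= f} have interiors containing {c < f}, up to
   discontinuities of f, so (IV) applies at every level: no choice of levels
   with null boundary is needed.  The layer at c = 0 is only controlled by the
   support of f, at a cost delta * nu (tsupport f). *)
Lemma ge0_integral_cvg f (M : R) : interior_closure_bounds nu_ nu ->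
  measurable_fun [set: borel X] f -> (forall x, (0 <= f x <= M)%R) ->
  metric_bounded (tsupport f) -> nu (discontinuity_set f) = 0 ->
  integral_cvg nu_ nu f.
Proof.
move=> icb mf f0M bf nuD.
have f0 x : (0 <= f x)%R by case/andP: (f0M x).
have mD := borel_discontinuity_set f.
have mK : (@open X).-sigma.-measurable (tsupport f).
  by apply: borel_closed; exact: closed_closure.
have mgt c : (@open X).-sigma.-measurable [set x | (c < f x)%R].
  exact: measurable_superlevel.
have mge c : (@open X).-sigma.-measurable [set x | (c <= f x)%R].
  exact: measurable_superlevel_le.
pose K := fine (nu (tsupport f)).
have K0 : (0 <= K)%R by rewrite fine_ge0.
pose M1 := (`|M| + 1)%R.
have M10 : (0 < M1)%R by rewrite ltr_wpDl.
have layers (e : R) : (0 < e)%R -> exists N (delta : R), [/\ (0 < delta)%R,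
    (delta * K <= e)%R & forall x, (f x <= N.+1%:R * delta)%R].
  move=> e0; pose N := Num.bound (M1 * K / e).
  exists N, (M1 / N.+1%:R)%R; split.
  - by rewrite divr_gt0.
  - rewrite mulrAC ler_pdivrMr// [leRHS]mulrC -ler_pdivrMr// ltW//.
    rewrite (lt_le_trans (archi_boundP _)) ?ler_nat//.
    by rewrite divr_ge0 ?mulr_ge0// ltW.
  - move=> x; rewrite mulrC divfK//.
    have /andP[_ /le_trans->]// := f0M x.
    by rewrite (le_trans (ler_norm _))// lerDl.
have pos_sub : [set x | (0 < f x)%R] `<=` tsupport f.
  by move=> x /lt0r_neq0 fx; exact: subset_closure.
have bgt c : (0 <= c)%R -> metric_bounded [set x | (c < f x)%R].
  move=> c0; apply: metric_bounded_sub bf => x cx; apply: pos_sub.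
  exact: le_lt_trans cx.
have bge c : (0 < c)%R -> metric_bounded [set x | (c <= f x)%R].
  move=> c0; apply: metric_bounded_sub bf => x cx; apply: pos_sub.
  exact: lt_le_trans cx.
have sup_gt c : (0 <= c)%R ->
    limn_esup (fun n => nu_ n [set x | (c < f x)%R]) <=
    nu (closure [set x | (c < f x)%R]).
  by move=> c0; have [] := icb _ (bgt c c0) (mgt c).
have inf_ge c : (0 < c)%R ->
    nu [set x | (c < f x)%R] <=
    limn_einf (fun n => nu_ n [set x | (c <= f x)%R]).
  move=> c0; have [+ _ _] := icb _ (bge c c0) (mge c); apply: le_trans.
  apply: (le_measure_null nu _ _ (discontinuity_set f)) => //.
    by apply: borel_open; exact: open_interior.
  exact: superlevel_sub_interior.
apply: limn_einf_esup_cvg; apply/lee_addgt0Pr => e /layers[N [delta [delta0 deltaK fN]]].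
- rewrite (le_trans (integral_le_layers nu f delta mf f0 delta0 N.+1 fN))//.
  rewrite big_ord_recl mul0r ge0_muleDr ?sume_ge0// addeC leeD//; last first.
    rewrite (@le_trans _ _ (delta * K)%:E)// ?lee_fin// EFinM lee_pmul2l//.
    by rewrite -finite_measureE// le_measure ?inE.
  rewrite (@le_trans _ _ (limn_einf (fun n => delta%:E *
      \sum_(i < N) nu_ n [set x | (i.+1%:R * delta <= f x)%R])))//; last first.
    by apply: le_limn_einf => n; exact: layers_le_integral.
  rewrite (eq_bigr (fun i : 'I_N =>
      (fine (nu [set x | (i.+1%:R * delta < f x)%R]))%:E)); last first.
    by move=> i _; exact: finite_measureE.
  rewrite sumEFin -EFinM; apply: limn_einf_geZ => //.
  apply: (limn_einf_ge_sum N
    (fun i n => nu_ n [set x | (i.+1%:R * delta <= f x)%R])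
    (fun i => fine (nu [set x | (i.+1%:R * delta < f x)%R]))) => i _.
  by rewrite -finite_measureE// inf_ge// mulr_gt0.
- rewrite (le_trans (le_limn_esup _ _ (fun n =>
    integral_le_layers (nu_ n) f delta mf f0 delta0 N.+1 fN)))//.
  pose l i :=
    if i is j.+1 then fine (nu [set x | (j.+1%:R * delta <= f x)%R]) else K.
  apply: (@le_trans _ _ (delta * \sum_(i < N.+1) l i)%:E).
    apply: limn_esup_leZ => //; apply: (limn_esup_le_sum N.+1
      (fun i n => nu_ n [set x | (i%:R * delta < f x)%R]) l) => i _.
    rewrite (le_trans (sup_gt _ _)) ?mulr_ge0 ?(ltW delta0)//; case: i => [|i] /=.
      rewrite -finite_measureE// mul0r le_measure ?inE//.
        by apply: borel_closed; exact: closed_closure.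
      by apply: closureS => x /lt0r_neq0.
    rewrite -finite_measureE//.
    apply: (le_measure_null nu _ _ (discontinuity_set f)) => //.
      by apply: borel_closed; exact: closed_closure.
    exact: closure_superlevel_sub.
  rewrite big_ord_recl /= mulrDr EFinD addeC leeD//.
  rewrite EFinM -sumEFin (eq_bigr (fun i : 'I_N =>
    nu [set x | (i.+1%:R * delta <= f x)%R])); last first.
    by move=> i _; rewrite -finite_measureE.
  exact: layers_le_integral.
Qed.

Lemma posneg_integral_cvg f : measurable_fun [set: borel X] f -> bounded_fun f ->
  integral_cvg nu_ nu f^\+%R -> integral_cvg nu_ nu f^\-%R ->
  integral_cvg nu_ nu f.
Proof.
move=> mf bf fp fn; rewrite /integral_cvg integralE.
under eq_fun do rewrite integralE.
rewrite funerpos funerneg; apply: cvgeB => //.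
apply: fin_num_adde_defr; apply: integrable_fin_num => //.
by apply: integrable_funrpos => //; exact: bounded_integrable.
Qed.

Lemma tsupport_sub f g : (forall x, f x = 0 -> g x = 0)%R ->
  tsupport g `<=` tsupport f.
Proof. by move=> fg; apply: closureS => x /=; apply: contra_neq => /fg. Qed.

Lemma discontinuity_setS f g :
  (forall x, {for x, continuous f} -> {for x, continuous g}) ->
  discontinuity_set g `<=` discontinuity_set f.
Proof. by move=> fg x; apply: contra_not; exact: fg. Qed.

Lemma continuous_discontinuity_set0 f :
  continuous f -> discontinuity_set f = set0.
Proof. by move=> cf; apply/seteqP; split => // x; apply; exact: cf. Qed.

Lemma bounded_integral_cvg f : interior_closure_bounds nu_ nu ->
  bounded_fun f -> measurable_fun [set: borel X] f ->
  metric_bounded (tsupport f) -> nu (discontinuity_set f) = 0 ->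
  integral_cvg nu_ nu f.
Proof.
move=> icb bdf mf bf nuD.
have [M [_ Mf]] := bdf; have {}Mf x : (`|f x| <= M + 1)%R.
  by apply: Mf => //; rewrite ltrDl.
have null g : discontinuity_set g `<=` discontinuity_set f ->
    nu (discontinuity_set g) = 0.
  move=> gf; apply/eqP; rewrite -measure_le0 -nuD.
  by rewrite le_measure ?inE//; exact: borel_discontinuity_set.
apply: posneg_integral_cvg => //.
- apply: (ge0_integral_cvg _ (M + 1)%R) => //.
  + exact: measurable_funrpos.
  + move=> x; rewrite /funrpos le_max lexx orbT/= ge_max (le_trans (ler_norm _) (Mf x)).
    by rewrite (le_trans _ (Mf x)).
  + apply: metric_bounded_sub bf; apply: tsupport_sub => x.
    by rewrite /funrpos => ->; rewrite maxxx.
  + apply: null; apply: discontinuity_setS => x fx.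
    by apply: continuous_max => //; exact: cvg_cst.
- apply: (ge0_integral_cvg _ (M + 1)%R) => //.
  + exact: measurable_funrneg.
  + move=> x; rewrite /funrneg le_max lexx orbT/= ge_max.
    rewrite (le_trans (ler_norm _)) ?normrN ?Mf//=.
    by rewrite (le_trans _ (Mf x)).
  + apply: metric_bounded_sub bf; apply: tsupport_sub => x.
    by rewrite /funrneg => ->; rewrite oppr0 maxxx.
  + apply: null; apply: discontinuity_setS => x fx.
    apply: continuous_max; last exact: cvg_cst.
    exact: cvgN.
Qed.

End integrals.

Section compactly_supported_functions.
Context {R : realType} {X : completeMetricType R}.
Implicit Types f g : X -> R.

Lemma Cc_bounded f : Cc f -> bounded_fun f.
Proof.
move=> [cf sf]; have /compact_bounded[M [_ fM]] : compact (f @` tsupport f).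
  by apply: continuous_compact => //; exact: continuous_subspaceT.
exists (Num.max M 0)%R; split; first exact: num_real.
move=> N; rewrite gt_max => /andP[MN N0] x _ /=.
have [->|fx] := eqVneq (f x) 0%R; first by rewrite normr0 ltW.
by apply: (fM N MN); exists x => //; exact: subset_closure.
Qed.

Lemma Cc_sub f g : Cc f -> continuous g ->
  (forall x, f x = 0 -> g x = 0)%R -> Cc g.
Proof.
move=> [_ sf] cg fg; split => //.
apply: (subclosed_compact _ sf); first exact: closed_closure.
exact: tsupport_sub.
Qed.

Lemma CcN f : Cc f -> Cc (fun x => - f x)%R.
Proof.
move=> Cf; apply: (Cc_sub _ _ Cf) => [x|x ->]; last by rewrite oppr0.
by apply: cvgN; exact: Cf.1.
Qed.

Lemma Cc_funrpos f : Cc f -> Cc f^\+%R.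
Proof.
move=> Cf; apply: (Cc_sub _ _ Cf) => [x|x]; last first.
  by rewrite /funrpos => ->; rewrite maxxx.
by apply: continuous_max; [exact: Cf.1|exact: cvg_cst].
Qed.

Lemma Cc_funrneg f : Cc f -> Cc f^\-%R.
Proof. by move=> /CcN/Cc_funrpos. Qed.

Lemma hoelder_unif_continuous f : hoelder_continuous f -> unif_continuous f.
Proof.
move=> [C [alpha [C0 /andP[alpha0 _] fC]]]; apply/unif_continuousP => e e0.
have C1 : (0 < C + 1)%R by rewrite ltr_wpDl.
have eC : (0 < e / (C + 1))%R by rewrite divr_gt0.
exists ((e / (C + 1)) `^ alpha^-1)%R; first by rewrite powR_gt0.
move=> [x y] /=; rewrite ballEmdist/= => xy; rewrite /ball/=.
rewrite (le_lt_trans (fC x y))//.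
rewrite (@le_lt_trans _ _ ((C + 1) * mdist x y `^ alpha)%R)//.
  by rewrite ler_wpM2r ?powR_ge0// lerDl.
rewrite mulrC -ltr_pdivlMr//.
have -> : (e / (C + 1) = ((e / (C + 1)) `^ alpha^-1) `^ alpha)%R.
  by rewrite -powRrM mulVf ?gt_eqF// powRr1// ltW.
by rewrite gt0_ltr_powR// ?nnegrE ?mdist_ge0 ?powR_ge0.
Qed.

Variables (nu_ : nat -> {finite_measure set (borel X) -> \bar R})
  (nu : {finite_measure set (borel X) -> \bar R}).

Lemma ge0_integral_cvgN g : (forall x, 0 <= g x)%R ->
  integral_cvg nu_ nu (fun x => - g x)%R <-> integral_cvg nu_ nu g.
Proof.
move=> g0.
have gN (mu : {finite_measure set (borel X) -> \bar R}) :
    \int[mu]_x (- g x)%:E = - \int[mu]_x (g x)%:E.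
  rewrite -integral_ge0N; last by move=> x _; rewrite lee_fin.
  by apply: eq_integral => x _; rewrite EFinN.
rewrite /integral_cvg gN; under eq_fun do rewrite gN.
split=> [/cvgeN|]; last exact: cvgeN.
by rewrite oppeK; under eq_fun do rewrite oppeK.
Qed.

Lemma interior_closure_vague_cvg : interior_closure_bounds nu_ nu ->
  vague_cvg nu_ nu.
Proof.
move=> icb f Cf; apply: bounded_integral_cvg => //.
- exact: Cc_bounded.
- exact: borel_continuous _ Cf.1.
- exact: compact_metric_bounded _ Cf.2.
- by rewrite continuous_discontinuity_set0 ?measure0//; exact: Cf.1.
Qed.

End compactly_supported_functions.

Theorem theorem2p3 (R : realType) (X : completeMetricType R)
    (sepX : separable_space X) (hbX : Heine_Borel_space X)
    (nu_ : nat -> {finite_measure set (borel X) -> \bar R})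
    (nu : {finite_measure set (borel X) -> \bar R}) :
  [<->
    (* I *)
    vague_cvg nu_ nu;
    (* II *)
    (forall A : set X, compact A -> limn_esup (fun n => nu_ n A) <= nu A) /\
    (forall B : set X, metric_bounded B -> open B ->
       nu B <= limn_einf (fun n => nu_ n B));
    (* III *)
    (forall A : set X, metric_bounded A -> closed A ->
       limn_esup (fun n => nu_ n A) <= nu A) /\
    (forall B : set X, metric_bounded B -> open B ->
       nu B <= limn_einf (fun n => nu_ n B));
    (* IV *)
    (forall A : set X, metric_bounded A -> (@open X).-sigma.-measurable A ->
       [/\ nu A° <= limn_einf (fun n => nu_ n A),
           limn_einf (fun n => nu_ n A) <= limn_esup (fun n => nu_ n A) &
           limn_esup (fun n => nu_ n A) <= nu (closure A)]);
    (* V *)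
    (forall A : set X, metric_bounded A -> (@open X).-sigma.-measurable A ->
       continuity_set nu A -> nu_ n A @[n --> \oo] --> nu A);
    (* VI *)
    (forall f : X -> R, continuous f -> metric_bounded (tsupport f) ->
       integral_cvg nu_ nu f);
    (* VII *)
    (forall f : X -> R, Cc f -> hoelder_continuous f -> integral_cvg nu_ nu f);
    (* VIII *)
    (forall f : X -> R, Cc f -> unif_continuous f -> integral_cvg nu_ nu f);
    (* IX *)
    (forall f : X -> R, bounded_fun f -> measurable_fun [set: borel X] f ->
       metric_bounded (tsupport f) -> nu (discontinuity_set f) = 0 ->
       integral_cvg nu_ nu f);
    (* X, non-negative version *)
    (forall f : X -> R, Cc f -> (forall x, (0 <= f x)%R) ->
       integral_cvg nu_ nu f);
    (* X, non-positive version *)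
    (forall f : X -> R, Cc f -> (forall x, (f x <= 0)%R) ->
       integral_cvg nu_ nu f)
  ].
Proof.
have cvg_icb : hoelder_cvg nu_ nu -> interior_closure_bounds nu_ nu.
  move=> hcvg; apply: limsup_liminf_interior_closure.
    exact: hoelder_limsup_closed.
  exact: hoelder_liminf_open.
have csc_icb : continuity_set_cvg nu_ nu -> interior_closure_bounds nu_ nu.
  move=> csc; apply: limsup_liminf_interior_closure.
    exact: continuity_set_limsup_closed.
  exact: continuity_set_liminf_open.
have tsupport_Cc (f : X -> R) : continuous f -> metric_bounded (tsupport f) -> Cc f.
  by move=> cf bf; split=> //; apply: hbX => //; exact: closed_closure.
tfae.
- move=> vcvg; have hcvg : hoelder_cvg nu_ nu by move=> f Cf _; exact: vcvg.
  split=> [A cA|]; last exact: hoelder_liminf_open.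
  apply: (hoelder_limsup_closed _ _ hbX hcvg); first exact: compact_metric_bounded.
  exact: compact_closed (@metric_hausdorff _ X) cA.
- by move=> [lsup linf]; split=> // A bA cA; apply: lsup; exact: hbX.
- by move=> [lsup linf]; exact: limsup_liminf_interior_closure.
- exact: interior_closure_continuity_set.
- move=> /csc_icb/interior_closure_vague_cvg vcvg f cf bf.
  exact/vcvg/tsupport_Cc.
- by move=> bcvg f [cf sf] _; apply: bcvg => //; exact: compact_metric_bounded.
- by move=> /cvg_icb/interior_closure_vague_cvg vcvg f Cf _; exact: vcvg.
- move=> ucvg f bdf mf bf nuD; apply: bounded_integral_cvg => //; apply: cvg_icb.
  by move=> g Cg /hoelder_unif_continuous; exact: ucvg.
- move=> dcvg f Cf _; apply: dcvg; first exact: Cc_bounded.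
  + exact: borel_continuous _ Cf.1.
  + exact: compact_metric_bounded _ Cf.2.
  + by rewrite continuous_discontinuity_set0 ?measure0//; exact: Cf.1.
- move=> pcvg f Cf f0; have fN0 x : (0 <= - f x)%R by rewrite oppr_ge0.
  have -> : f = (fun x => - - f x)%R by apply/funext => x; rewrite opprK.
  by apply/ge0_integral_cvgN => //; apply: pcvg => //; exact: CcN.
- move=> ncvg f Cf; apply: posneg_integral_cvg.
  + exact: borel_continuous _ Cf.1.
  + exact: Cc_bounded.
  + have fp0 x : (0 <= f^\+%R x)%R by exact: funrpos_ge0.
    apply/ge0_integral_cvgN => //; apply: ncvg; first exact/CcN/Cc_funrpos.
    by move=> x; rewrite oppr_le0.
  + have fn0 x : (0 <= f^\-%R x)%R by exact: funrneg_ge0.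
    apply/ge0_integral_cvgN => //; apply: ncvg; first exact/CcN/Cc_funrneg.
    by move=> x; rewrite oppr_le0.
Qed.
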